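(* Let a rate-distortion problem have source and reproduction alphabet sizes $N$ and $M$, respectively. For $l\ge2$, the computational complexity of root tracking for rate-distortion of order $l$ with tensor memorization (see context) is bounded by $$O\Big(N\cdot(M+l)^{3l+5/2}\,e^{(2M+l)H_e(\rho)+\pi\sqrt{2l/3}}\Big)$$ times the number of grid points, where $\rho:=\frac{2M}{2M+l}$ and $H_e(\cdot)$ is the binary entropy in nats. For $l=1$, it is instead $O(M^3N)$ times the number of grid points. The algorithm's memory complexity is bounded by $$O\big(l^{\,l+5/2}\ln l\big)+O(MNl^2)+O(M^l\,l).$$
   Context: Problem data: finite alphabets $\mathcal{X}$ ($|\mathcal{X}|=N$), $\hat{\mathcal{X}}$ ($|\hat{\mathcal{X}}|=M$), source distribution $p_X$, distortion $d:\mathcal{X}\times\hat{\mathcal{X}}\to\mathbb{R}_{\ge0}$. $F(\bm{r},\beta)=\bm{r}-BA_\beta[\bm{r}]$, $BA_\beta[\bm{r}](\hat{x})=\sum_xp_X(x)q(\hat{x}|x)$, $q(\hat{x}|x)=\frac{r(\hat{x})e^{-\beta d(x,\hat{x})}}{\sum_{\hat{x}'}r(\hat{x}')e^{-\beta d(x,\hat{x}')}}$. Algorithm: along a grid $\beta_0>\beta_1>\dots$, at each grid point with current approximation $\bm{r}$ (of full support on the current alphabet, of size at most $M$), compute the implicit derivatives $\frac{d^k\bm{r}}{d\beta^k}$, $k=1,\dots,l$, and take a Taylor step of order $l$. The $k$-th derivative is computed by solving (Gaussian elimination) the linear system $$D_{\bm{r}}F\big[\tfrac{d^k\bm{r}}{d\beta^k}\big]=-\sum\sum_{b=0}^{m_1\delta(p_1=1)}\frac{k!}{b!(m_1-b)!m_2!\cdots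 m_s!(p_1!)^{m_1}\cdots(p_s!)^{m_s}}D^m_{\beta^b,\bm{r}^{m-b}}F\big[(\tfrac{d^{p_1}\bm{r}}{d\beta^{p_1}})_{\times(m_1-b)},\dots,(\tfrac{d^{p_s}\bm{r}}{d\beta^{p_s}})_{\times m_s}\big]$$ (outer sum over non-trivial partitions $k=m_1p_1+\dots+m_sp_s$, $0<p_1<\dots<p_s$; $m=\sum m_i$; $(\bm v)_{\times j}$ is $\bm v$ repeated $j$ times; for $k=1$ the right-hand side is $-D_\beta F$), where $D^{b+j}_{\beta^b,\bm{r}^j}F$ is the tensor with $M^{j+1}$ entries $\partial^j_{r_{i_1}\cdots r_{i_j}}\partial^b_\beta F_i$, evaluated naively as a multilinear form. Tensor memorization: at each grid point every derivative tensor is computed only once and reused, and lower-order implicit derivatives are stored. Computation of the tensors: let $\bar d$ be the derivation of $\mathbb{R}[x_0,x_1,\dots]$ with $\bar dx_0=0$, $\bar dx_k=x_1x_k-x_{k+1}$ ($k>0$), $P_0=1$, $P_{k+1}=(x_1-x_0)P_k+\bar dP_k$. At each grid point one computes $E_k(x)=\sum_{\hat{x}'}q(\hat{x}'|x)d(x,\hat{x}')^k$ and the $M\times N$ matrices $P_k(\hat{x},x)=P_k(d(x,\hat{x}),E_1(x),\dots,E_k(x))$ monomial by monomial for $k\le l$, then the $M\times N$ matrices $G(k,a)_{(\hat{x},x)}=\sum_{\bm{t}\in\mathbb{N}_0^k:|\bm{t}|\le a,\sum jt_j=k}\frac{1}{\bm{t}!(a-|\bm{t}|)!}\prod_{j=1}^k(P_j(\hat{x},x)/j!)^{t_j}$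 for $0\le k\le l$, $0\le a\le l+1$ (a single pass over partitions $\bm{t}$), and then $\partial_\beta^bF(\hat{x})=-\sum_xp_X(x)q(\hat{x}|x)P_b(\hat{x},x)$ and, for $\bm{\alpha}=(\alpha_0,\bm{\alpha}_+)\in\mathbb{N}_0^{1+M}$, $\bm{\alpha}_+\ne\bm{0}$, $$\partial_\beta^{\alpha_0}\partial_{\bm{r}}^{\bm{\alpha}_+}F(\hat{x})=\delta_{\bm{\alpha},\bm{e}_{\hat{x}}}-(-1)^{|\bm{\alpha}_+|-1}(|\bm{\alpha}_+|-1)!\,\bm{\alpha}!\sum_xp_X(x)\prod_i\Big(\tfrac{q(\hat{x}_i|x)}{r(\hat{x}_i)}\Big)^{\alpha_i}\sum_{|\bm{k}|=\alpha_0}\Big(\prod_{\hat{x}_i\ne\hat{x}}G(k_i,\alpha_i)_{(\hat{x}_i,x)}\Big)\big[\alpha_{\hat{x}}G(k_{\hat{x}},\alpha_{\hat{x}})_{(\hat{x},x)}-|\bm{\alpha}_+|(1+\alpha_{\hat{x}})q(\hat{x}|x)G(k_{\hat{x}},1+\alpha_{\hat{x}})_{(\hat{x},x)}\big],$$ each multi-index entry being computed once and copied to all tensor positions (orderings of differentiations) it corresponds to. Accounting conventions: computational complexity counts arithmetic and copy operations for the implicit derivatives at the grid points. Not counted: the one-time computation of the coefficients of the polynomials $P_k$ (independent of problem and point), the powers $d(x,\hat{x})^k$, and the invocations of the Blahut-Arimoto iteration used to handle bifurcations. Memory counts: the polynomials $P_k$, $k\le l$, stored as sums of monomials with coefficients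 $\pm1$, each monomial encoded in $1+(k+1)\log_2(k+1)$ bits; the arrays $E_k$, $P_k(\hat{x},x)$, $G(k,a)$ (one unit per entry); and the memorized derivative tensors $D^{m}_{\beta^b,\bm{r}^{m-b}}F$ with $0\le b\le m<l$ (one unit per entry). Memory is reused across grid points. *)

(* Defs.v *)
From HB Require Import structures.
From mathcomp Require Import all_boot all_order all_algebra.
From mathcomp Require Import reals sequences exp trigo.

Set Implicit Arguments.
Unset Strict Implicit.
Unset Printing Implicit Defensive.

Import Order.TTheory GRing.Theory Num.Theory.
Local Open Scope ring_scope.

(* Cost model.  An algorithm is a term of the writer monad [counted].  The only
   sources of cost are the unit-cost primitives [cadd] ... [ccopy] below:
   arithmetic on reals, and copying a real into an array.  Loop control,
   indexing, enumeration of index sets, reading of an array and zero tests are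
   not charged. *)

Record counted (A : Type) := Counted { ops : nat; result : A }.

Definition cret A (a : A) : counted A := Counted 0 a.
Definition cbind A B (m : counted A) (f : A -> counted B) : counted B :=
  Counted (ops m + ops (f (result m))) (result (f (result m))).

Notation "'let!' x := m 'in' e" := (cbind m (fun x => e))
  (at level 200, x name, m at level 100, e at level 200).

Fixpoint cmap I A (f : I -> counted A) (s : seq I) : counted (seq A) :=
  if s is i :: s' then
    let! a := f i in let! t := cmap f s' in cret (a :: t)
  else cret [::].

Fixpoint cfold I A (f : A -> I -> counted A) (a : A) (s : seq I) : counted A :=
  if s is i :: s' then let! b := f a i in cfold f b s' else cret a.

(* Arrays are association lists; [size] is their number of entries. *)
Definition table (K V : Type) := seq (K * V).

Definition tabulate (K V : Type) (s : seq K) (f : K -> counted V) :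
    counted (table K V) :=
  cmap (fun k => let! v := f k in cret (k, v)) s.

Definition read (K : eqType) (V : Type) (v0 : V) (t : table K V) (k : K) : V :=
  (nth (k, v0) t (find (fun kv => kv.1 == k) t)).2.

Section Arithmetic.
Variable R : realType.
Implicit Types x y : R.

Definition cadd x y := Counted 1 (x + y).
Definition csub x y := Counted 1 (x - y).
Definition cmul x y := Counted 1 (x * y).
Definition cdiv x y := Counted 1 (x / y).
Definition copp x := Counted 1 (- x).
Definition cexp x := Counted 1 (expR x).
Definition ccopy x := Counted 1 x.

Definition csum I (s : seq I) (f : I -> counted R) : counted R :=
  cfold (fun acc i => let! v := f i in cadd acc v) 0 s.

Definition cprod I (s : seq I) (f : I -> counted R) : counted R :=
  cfold (fun acc i => let! v := f i in cmul acc v) 1 s.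

Fixpoint cpow x (n : nat) : counted R :=
  if n is n'.+1 then let! y := cpow x n' in cmul x y else cret 1.

Fixpoint cfact (n : nat) : counted R :=
  if n is n'.+1 then let! y := cfact n' in cmul n%:R y else cret 1.

(* Gaussian elimination on the rows of an n x (n+1) augmented matrix, pivoting
   on the first nonzero entry of the current column; returns the n unknowns.
   When the matrix is singular the output is meaningless. *)
Fixpoint gauss (n : nat) (rows : seq (seq R)) : counted (seq R) :=
  if n is n'.+1 then
    let p := find (fun row => head 0 row != 0) rows in
    let! pivot := cmap ccopy (nth (head [::] rows) rows p) in
    let! moved := cmap ccopy (head [::] rows) in
    let rest := behead (set_nth [::] rows p moved) in
    let! reduced := cmap (fun row =>
        let! c := cdiv (head 0 row) (head 0 pivot) in
        cmap (fun uv => let! w := cmul c uv.2 in csub uv.1 w)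
             (zip (behead row) (behead pivot)))
      (take n' rest) in
    let! sol := gauss n' reduced in
    let! s := csum (zip (behead pivot) sol) (fun uv => cmul uv.1 uv.2) in
    let! num := csub (last 0 pivot) s in
    let! z := cdiv num (head 0 pivot) in
    cret (z :: sol)
  else cret [::].

End Arithmetic.

(* The polynomials P_k as sums of monomials with coefficients +1 and -1: the
   signed monomial (s, [:: i_1; ...; i_m]) stands for (-1)^s x_{i_1}...x_{i_m}.
   A coefficient c of P_k thus amounts to |c| equal signed monomials (there is
   no cancellation). *)
Definition monomial := (bool * seq nat)%type.

Definition mmul (v : seq nat) (m : monomial) : monomial := (m.1, v ++ m.2).
Definition mopp (m : monomial) : monomial := (~~ m.1, m.2).

(* The derivation sending x_0 to 0 and x_k to x_1 x_k - x_{k+1} for k > 0,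
   extended to monomials by the Leibniz rule. *)
Fixpoint dbar_vars (v : seq nat) : seq monomial :=
  if v is i :: v' then
    (if i is 0 then [::] else [:: (false, [:: 1, i & v']); (true, i.+1 :: v')])
    ++ [seq mmul [:: i] m | m <- dbar_vars v']
  else [::].

Definition dbar (q : seq monomial) : seq monomial :=
  flatten [seq (if m.1 then map mopp (dbar_vars m.2) else dbar_vars m.2)
          | m <- q].

Fixpoint Ppoly (k : nat) : seq monomial :=
  if k is k'.+1 then
    [seq mmul [:: 1%N] m | m <- Ppoly k'] ++
    [seq mopp (mmul [:: 0%N] m) | m <- Ppoly k'] ++ dbar (Ppoly k')
  else [:: (false, [::])].

Definition peval (A : comPzRingType) (x : nat -> A) (q : seq monomial) : A :=
  \sum_(m <- q) (-1) ^+ m.1 * \prod_(i <- m.2) x i.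

Section PpolySpec.
Variables (A : comPzRingType) (x : nat -> A) (D : A -> A).
Hypothesis DD : forall u v, D (u + v) = D u + D v.
Hypothesis DM : forall u v, D (u * v) = D u * v + u * D v.
Hypothesis Dx0 : D (x 0%N) = 0.
Hypothesis DxS : forall k, D (x k.+1) = x 1%N * x k.+1 - x k.+2.

Lemma peval_cat q1 q2 : peval x (q1 ++ q2) = peval x q1 + peval x q2.
Proof. by rewrite /peval big_cat. Qed.

Lemma peval_mmul v q :
  peval x [seq mmul v m | m <- q] = (\prod_(i <- v) x i) * peval x q.
Proof.
rewrite /peval big_map big_distrr; apply: eq_bigr => m _ /=.
by rewrite big_cat mulrCA.
Qed.

Lemma peval_mopp q : peval x [seq mopp m | m <- q] = - peval x q.
Proof.
rewrite /peval big_map -sumrN; apply: eq_bigr => m _ /=.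
by rewrite signrN mulNr.
Qed.

Lemma peval_dbar_vars v : peval x (dbar_vars v) = D (\prod_(i <- v) x i).
Proof.
have D1 : D 1 = 0.
  by have /esym/eqP := DM 1 1; rewrite !mul1r mulr1 -subr_eq0 addrK => /eqP.
elim: v => [|i v IHv] /=; first by rewrite /peval !big_nil D1.
rewrite peval_cat peval_mmul IHv big_seq1 big_cons DM; congr (_ + _).
case: i => [|i]; first by rewrite /peval big_nil Dx0 mul0r.
rewrite DxS /peval /=; do !rewrite big_cons /=.
by rewrite big_nil addr0 expr0 expr1 mul1r mulN1r mulrBl mulrA.
Qed.

Lemma peval_dbar q : peval x (dbar q) = D (peval x q).
Proof.
have D0 : D 0 = 0.
  by have /esym/eqP := DD 0 0; rewrite addr0 -subr_eq0 addrK => /eqP.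
have DN u : D (- u) = - D u.
  by apply/eqP; rewrite -addr_eq0 -DD addNr D0.
elim: q => [|[s v] q IHq]; first by rewrite /peval /= !big_nil D0.
rewrite /dbar /= peval_cat [peval x (flatten _)]IHq.
rewrite [peval x ((s, v) :: q)]/peval big_cons DD; congr (_ + _).
by case: s; rewrite /= ?peval_mopp peval_dbar_vars ?mul1r // mulN1r DN.
Qed.

Lemma peval_PpolyS k :
  peval x (Ppoly k.+1)
  = (x 1%N - x 0%N) * peval x (Ppoly k) + D (peval x (Ppoly k)).
Proof.
rewrite /= !peval_cat peval_dbar peval_mmul.
rewrite (map_comp mopp (mmul [:: 0%N])) peval_mopp peval_mmul !big_seq1.
by rewrite addrA mulrBl.
Qed.

End PpolySpec.

Section IndexSets.
Variable Y : finType.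
Implicit Type A : {set Y}.

Definition words A (j : nat) : seq (seq Y) :=
  [seq tval w | w <- enum {: j.-tuple Y} & all (mem A) (tval w)].

(* multi-indices of weight s supported in A *)
Definition multi_indices A (s : nat) : seq {ffun Y -> nat} :=
  [seq [ffun y => val (f y)]
  | f : {ffun Y -> 'I_s.+1} <- enum {: {ffun Y -> 'I_s.+1}}
  & (\sum_y val (f y) == s)%N && [forall y, (y \notin A) ==> (val (f y) == 0%N)]].

(* number of differentiations in each direction along the word w *)
Definition multiplicities (w : seq Y) : {ffun Y -> nat} :=
  [ffun y => count_mem y w].

End IndexSets.

(* The partitions of k; t i is the multiplicity of the part i+1. *)
Definition partitions (k : nat) : seq {ffun 'I_k -> nat} :=
  [seq [ffun i => val (t i)]
  | t : {ffun 'I_k -> 'I_k.+1} <- enum {: {ffun 'I_k -> 'I_k.+1}}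
  & (\sum_(i : 'I_k) i.+1 * val (t i) == k)%N].

Record rd_problem (R : realType) (X Y : finType) := RDProblem {
  source : X -> R;
  source_ge0 : forall x, 0 <= source x;
  source_sum1 : \sum_x source x = 1;
  distortion : X -> Y -> R;
  distortion_ge0 : forall x y, 0 <= distortion x y;
  reproduction_gt0 : (0 < #|Y|)%N
}.

(* An approximation of full support on the current reproduction alphabet. *)
Record approximation (R : realType) (Y : finType) := Approximation {
  alphabet : {set Y};
  alphabet_neq0 : alphabet != set0;
  weight : Y -> R;
  weight_gt0 : forall y, y \in alphabet -> 0 < weight y
}.

Section GridPoint.
Variables (R : realType) (X Y : finType) (pb : rd_problem R X Y) (l : nat).
Variables (beta : R) (approx : approximation R Y).

Local Notation p := (source pb).
Local Notation d := (distortion pb).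
Local Notation A := (alphabet approx).
Local Notation r := (weight approx).
Local Notation Xs := (enum X).
Local Notation Ys := (enum A).

(* q (y, x) = r y exp(-beta d x y) / \sum_y' r y' exp(-beta d x y').  The root
   being tracked is that of F(r, beta) y = r y - \sum_x p x * q (y, x). *)
Definition compute_q : counted (table (Y * X) R) :=
  let! num := tabulate (allpairs pair Ys Xs) (fun yx =>
      let! e := cmul beta (d yx.2 yx.1) in
      let! ne := copp e in
      let! w := cexp ne in cmul (r yx.1) w) in
  let! den := tabulate Xs (fun x => csum Ys (fun y => cret (read 0 num (y, x)))) in
  tabulate (allpairs pair Ys Xs) (fun yx =>
    cdiv (read 0 num yx) (read 0 den yx.2)).

Section WithQ.
Variable q : Y -> X -> R.

(* The powers of the distortion are precomputed, hence not charged. *)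
Definition compute_E : counted (table (nat * X) R) :=
  tabulate (allpairs pair (iota 1 l) Xs) (fun kx =>
    csum Ys (fun y => cmul (q y kx.2) (d kx.2 y ^+ kx.1))).

(* The monomial (s, v) at x_0 = d(x, y), x_k = E_k(x). *)
Definition eval_monomial (E : nat -> X -> R) (y : Y) (x : X) (m : monomial) :
    counted R :=
  let! e := cprod [seq i <- m.2 | i != 0%N] (fun i => cret (E i x)) in
  let! v := cmul (d x y ^+ count_mem 0%N m.2) e in
  if m.1 then copp v else cret v.

Definition compute_P (E : nat -> X -> R) : counted (table (nat * (Y * X)) R) :=
  tabulate (allpairs pair (iota 0 l.+1) (allpairs pair Ys Xs)) (fun kyx =>
    csum (Ppoly kyx.1) (eval_monomial E kyx.2.1 kyx.2.2)).

(* The row G(k, 0), ..., G(k, l+1) at (y, x), accumulated in a single pass over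
   the partitions t of k. *)
Definition G_row (P : nat -> Y -> X -> R) (k : nat) (y : Y) (x : X) :
    counted (seq R) :=
  cfold (fun row (t : {ffun 'I_k -> nat}) =>
      let! num := cprod (enum 'I_k) (fun i =>
          let! f := cfact R i.+1 in
          let! u := cdiv (P i.+1 y x) f in cpow u (t i)) in
      let! den := cprod (enum 'I_k) (fun i => cfact R (t i)) in
      let! c := cdiv num den in
      let size_t := (\sum_i t i)%N in
      cmap (fun av =>
          if (size_t <= av.1)%N then
            let! f := cfact R (av.1 - size_t) in
            let! u := cdiv c f in cadd av.2 u
          else cret av.2)
        (zip (iota 0 l.+2) row))
    (nseq l.+2 0) (partitions k).

Definition compute_G (P : nat -> Y -> X -> R) :
    counted (table (nat * (Y * X)) (seq R)) :=
  tabulate (allpairs pair (iota 0 l.+1) (allpairs pair Ys Xs)) (fun kyx =>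
    G_row P kyx.1 kyx.2.1 kyx.2.2).

Section Tensors.
Variables (P : nat -> Y -> X -> R) (G : nat -> nat -> Y -> X -> R).

(* The y-component of the b-th derivative of F in beta; for b = 0, F itself.
   The b-th derivative of q y x in beta is q y x * P b y x. *)
Definition beta_entry (b : nat) (y : Y) : counted R :=
  let! s := csum Xs (fun x =>
      let! u := cmul (p x) (q y x) in
      if b is 0 then cret u else cmul u (P b y x)) in
  if b is 0 then csub (r y) s else copp s.

(* The y-component of the derivative of F of order b in beta and of multi-order
   al != 0 in r; the sum over k distributes the b differentiations in beta over
   the factors indexed by the alphabet. *)
Definition mixed_entry (b : nat) (al : {ffun Y -> nat}) (y : Y) : counted R :=
  let j := (\sum_z al z)%N in
  let delta : R := ((b == 0%N) && (al == [ffun z => nat_of_bool (z == y)]))%:R in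
  let! sg := cpow (-1) j.-1 in
  let! fj := cfact R j.-1 in
  let! fb := cfact R b in
  let! fal := cprod Ys (fun z => cfact R (al z)) in
  let! c1 := cmul sg fj in
  let! c2 := cmul c1 fb in
  let! c := cmul c2 fal in
  let! s := csum Xs (fun x =>
      let! w := cprod Ys (fun z =>
          let! u := cdiv (q z x) (r z) in cpow u (al z)) in
      let! g := csum (multi_indices A b) (fun k =>
          let! others := cprod [seq z <- Ys | z != y]
              (fun z => cret (G (k z) (al z) z x)) in
          let! u1 := cmul (al y)%:R (G (k y) (al y) y x) in
          let! u2 := cadd 1 (al y)%:R in
          let! u3 := cmul j%:R u2 in
          let! u4 := cmul u3 (q y x) in
          let! u5 := cmul u4 (G (k y) (al y).+1 y x) in
          let! bracket := csub u1 u5 in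
          cmul others bracket) in
      let! pw := cmul (p x) w in
      cmul pw g) in
  let! cs := cmul c s in
  csub delta cs.

(* A table entry (b, y, [:: y_1; ...; y_j]) is the y-component of the
   derivative of F of order b in beta and in the directions r(y_1), ..., r(y_j).
   [tensors m] computes all the tensors of total order b + j = m, evaluating
   each multi-index entry once and copying it to its tensor positions. *)
Definition tensor_table := table (nat * (Y * seq Y)) R.

Definition tensor (b j : nat) : counted tensor_table :=
  if j is 0 then
    tabulate [seq (b, (y, [::])) | y <- Ys] (fun byw => beta_entry b byw.2.1)
  else
    let! entries := tabulate (allpairs pair Ys (multi_indices A j))
        (fun yal => mixed_entry b yal.2 yal.1) in
    tabulate [seq (b, yw) | yw <- allpairs pair Ys (words A j)] (fun byw =>
      ccopy (read 0 entries (byw.2.1, multiplicities byw.2.2))).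

Definition tensors (m : nat) : counted tensor_table :=
  let! ts := cmap (fun b => tensor b (m - b)) (iota 0 m.+1) in
  cret (flatten ts).

End Tensors.
End WithQ.

Section ImplicitDerivatives.
Variable T : nat -> Y -> seq Y -> R.

(* the derivatives of r in beta already computed: [dr k y] is of order k *)
Variable dr : nat -> Y -> R.

(* the multilinear form of order b in beta and order [size args] in r, applied
   to the derivatives of r whose orders are listed in args *)
Definition multilinear (b : nat) (args : seq nat) (y : Y) : counted R :=
  csum (words A (size args)) (fun w =>
    let! v := cprod (zip args w) (fun kz => cret (dr kz.1 kz.2)) in
    cmul (T b y w) v).

(* The multiplicity m_1 delta(p_1 = 1) of the part 1. *)
Definition mult1 (k : nat) (t : {ffun 'I_k -> nat}) : nat :=
  (\sum_(i | val i == 0) t i)%N.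

Definition rhs_coef (k : nat) (t : {ffun 'I_k -> nat}) (b : nat) : counted R :=
  let! num := cfact R k in
  let! f1 := cfact R b in
  let! f2 := cfact R (mult1 t - b) in
  let! f3 := cprod [seq i <- enum 'I_k | val i != 0%N] (fun i => cfact R (t i)) in
  let! f4 := cprod (enum 'I_k) (fun i =>
      let! f := cfact R i.+1 in cpow f (t i)) in
  let! g1 := cmul f1 f2 in
  let! g2 := cmul g1 f3 in
  let! den := cmul g2 f4 in
  cdiv num den.

Definition rhs_args (k : nat) (t : {ffun 'I_k -> nat}) (b : nat) : seq nat :=
  flatten [seq nseq (t i - (if val i == 0%N then b else 0%N)) i.+1
          | i <- enum 'I_k].

Definition rhs (k : nat) : counted (seq R) :=
  if k == 1%N then cmap (fun y => copp (T 1 y [::])) Ys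
  else
    let nontrivial := [seq t : {ffun 'I_k -> nat} <- partitions k | (1 < \sum_i t i)%N] in
    let! terms := cmap (fun tb : {ffun 'I_k -> nat} * nat =>
          let! c := rhs_coef tb.1 tb.2 in cret (c, (tb.2, rhs_args tb.1 tb.2)))
        [seq (t, b) | t <- nontrivial, b <- iota 0 (mult1 t).+1] in
    cmap (fun y =>
        let! s := csum terms (fun term =>
            let! v := multilinear term.2.1 term.2.2 y in cmul term.1 v) in
        copp s)
      Ys.

Definition implicit_derivative (k : nat) : counted (table Y R) :=
  let! b := rhs k in
  let! rows := cmap (fun yb =>
        cmap (@ccopy R) (rcons [seq T 0 yb.1 [:: z] | z <- Ys] yb.2))
      (zip Ys b) in
  let! sol := gauss (size Ys) rows in
  cret (zip Ys sol).

End ImplicitDerivatives.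

(* One stage of the loop over the orders k = 1, ..., l: the tensors of total
   order k are computed, those of lower order being read from the memo; they
   are memorized if k < l. *)
Definition derivative_stage q P G
    (st : tensor_table * seq (table Y R)) (k : nat) :
    counted (tensor_table * seq (table Y R)) :=
  let! new := tensors q P G k in
  let known := st.1 ++ new in
  let! v := implicit_derivative
      (fun b y w => read 0 known (b, (y, w)))
      (fun k' y => read 0 (nth [::] st.2 k'.-1) y) k in
  cret (if (k < l)%N then known else st.1, rcons st.2 v).

Record grid_record := GridRecord {
  E_array : table (nat * X) R;
  P_array : table (nat * (Y * X)) R;
  G_array : table (nat * (Y * X)) (seq R);
  memo : tensor_table;
  derivatives : seq (table Y R)
}.

Definition grid_point : counted grid_record :=
  let! tq := compute_q in
  let q y x := read 0 tq (y, x) in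
  let! tE := compute_E q in
  let! tP := compute_P (fun k x => read 0 tE (k, x)) in
  let P k y x := read 0 tP (k, (y, x)) in
  let! tG := compute_G P in
  let G k a y x := nth 0 (read [::] tG (k, (y, x))) a in
  let! t0 := tensors q P G 0 in
  let! st := cfold (derivative_stage q P G) (t0, [::]) (iota 1 l) in
  cret (GridRecord tE tP tG st.1 st.2).

Definition taylor_step (step : R) (drs : seq (table Y R)) : counted (table Y R) :=
  tabulate Ys (fun y =>
    let! s := csum (iota 1 l) (fun k =>
        let! h := cpow step k in
        let! f := cfact R k in
        let! c := cdiv h f in
        cmul c (read 0 (nth [::] drs k.-1) y)) in
    cadd (r y) s).

End GridPoint.

Section RootTracking.
Variables (R : realType) (X Y : finType) (pb : rd_problem R X Y) (l : nat).

(* The uncharged handling of bifurcations: from the new grid point, the current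
   alphabet and the outcome of the Taylor step, it returns an approximation of
   full support on the new current alphabet. *)
Definition bifurcation_handler := R -> {set Y} -> (Y -> R) -> approximation R Y.
Variable handler : bifurcation_handler.

Fixpoint root_tracking (grid : seq R) (a : approximation R Y) :
    counted (seq (grid_record R X Y)) :=
  if grid is beta :: grid' then
    let! g := grid_point pb l beta a in
    if grid' is beta' :: _ then
      let! v := taylor_step l a (beta' - beta) (derivatives g) in
      let! gs := root_tracking grid' (handler beta' (alphabet a) (read 0 v)) in
      cret (g :: gs)
    else cret [:: g]
  else cret [::].

Definition computational_complexity (grid : seq R) (a : approximation R Y) : nat :=
  ops (root_tracking grid a).

Definition polynomial_memory : R :=
  \sum_(0 <= k < l.+1)
    (size (Ppoly k))%:R * (1 + k.+1%:R * (ln k.+1%:R / ln 2)).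

Definition grid_memory (g : grid_record R X Y) : nat :=
  (size (E_array g) + size (P_array g) + sumn [seq size kv.2 | kv <- G_array g]
   + size (memo g))%N.

(* memory is reused across grid points *)
Definition memory_complexity (grid : seq R) (a : approximation R Y) : R :=
  polynomial_memory + (\max_(g <- result (root_tracking grid a)) grid_memory g)%:R.

End RootTracking.

(* the binary entropy in nats *)
Definition binary_entropy (R : realType) (x : R) : R :=
  - (x * ln x) - (1 - x) * ln (1 - x).

(* Main.v *)
Require Import Defs.
From mathcomp Require Import all_boot all_order all_algebra.
From mathcomp Require Import reals sequences exp trigo.
From mathcomp Require Import zify ring lra.

(* Every count is bounded by elementary powers: a multi-index of weight s is
   the multiplicity vector of a word of length s, so there are at most M^s of
   them; k has at most (k+1)^k partitions; the Leibniz rule multiplies the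
   number of monomials by at most 2(k+1) when passing from P_k to P_{k+1}, so
   P_k has at most 2^k k! <= 2 k^k of them.  The cost of a grid point is then
   O(N (M (l+1)^(l+4) + M^(l+1) (l+1)^(l+3) + (l+1)^2 M^(l+2))).  For l >= 2
   this is O(N (M+l)^(3l+2)), and the exponential factor of the claimed bound
   is at least 1; for l = 1 it is O(N M^3).  The same counts give the memory
   bound, where M^l l dominates the sum of the sizes M^(j+1) of the memorized
   tensors up to a term l^2, which appears when M = 1. *)

Set Implicit Arguments.
Unset Strict Implicit.
Unset Printing Implicit Defensive.

Import Order.TTheory GRing.Theory Num.Theory.
Local Open Scope nat_scope.

(** * Cost calculus for the writer monad and its loops *)

Lemma leq_sum_seq_size (I : eqType) (s : seq I) (f : I -> nat) (c : nat) :
  (forall i, i \in s -> f i <= c) -> \sum_(i <- s) f i <= size s * c.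
Proof.
move=> f_le; rewrite big_seq (leq_trans (leq_sum _ f_le)) //.
by rewrite -big_seq big_const_seq count_predT iter_addn_0 mulnC.
Qed.

Lemma ops_bind (A B : Type) (m : counted A) (f : A -> counted B) :
  ops (cbind m f) = ops m + ops (f (result m)).
Proof. by []. Qed.

Lemma result_bind (A B : Type) (m : counted A) (f : A -> counted B) :
  result (cbind m f) = result (f (result m)).
Proof. by []. Qed.

Lemma ops_bind_le (A B : Type) (m : counted A) (f : A -> counted B) a b :
  ops m <= a -> ops (f (result m)) <= b -> ops (cbind m f) <= a + b.
Proof. exact: leq_add. Qed.

Lemma result_cmap (I : eqType) (B : Type) (f : I -> counted B) s :
  result (cmap f s) = [seq result (f i) | i <- s].
Proof. by elim: s => //= i s ->. Qed.

Lemma ops_cmap (I : eqType) (B : Type) (f : I -> counted B) s :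
  ops (cmap f s) = \sum_(i <- s) ops (f i).
Proof.
by elim: s => [|i s IHs]; rewrite ?big_nil ?big_cons //= addn0 IHs.
Qed.

Lemma ops_cmap_le (I : eqType) (B : Type) (f : I -> counted B) (s : seq I) c :
  (forall i, i \in s -> ops (f i) <= c) -> ops (cmap f s) <= size s * c.
Proof. by rewrite ops_cmap; apply: leq_sum_seq_size. Qed.

Lemma ops_cfold_le (I : eqType) (B : Type) (f : B -> I -> counted B) a (s : seq I) c :
  (forall b i, i \in s -> ops (f b i) <= c) -> ops (cfold f a s) <= size s * c.
Proof.
elim: s a => //= i s IHs a f_le; rewrite mulSn leq_add ?f_le ?mem_head //.
by apply: IHs => b j sj; rewrite f_le // inE sj orbT.
Qed.

Lemma cfold_ind (I : eqType) (B : Type) (Q : B -> Prop) (f : B -> I -> counted B) a s :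
  Q a -> (forall b i, Q b -> Q (result (f b i))) -> Q (result (cfold f a s)).
Proof. by move=> Qa Qf; elim: s a Qa => //= i s IHs a Qa; apply/IHs/Qf. Qed.

Lemma ops_tabulate_le (I : eqType) (B : Type) (f : I -> counted B) (s : seq I) c :
  (forall i, i \in s -> ops (f i) <= c) -> ops (tabulate s f) <= size s * c.
Proof.
move=> f_le; rewrite /tabulate ops_cmap leq_sum_seq_size // => i /f_le.
by rewrite ops_bind addn0.
Qed.

Lemma result_tabulate (I : eqType) (B : Type) (f : I -> counted B) s :
  result (tabulate s f) = [seq (i, result (f i)) | i <- s].
Proof.
by rewrite /tabulate; elim: s => //= i s ->.
Qed.

Lemma size_tabulate (I : eqType) (B : Type) (f : I -> counted B) s :
  size (result (tabulate s f)) = size s.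
Proof. by rewrite result_tabulate size_map. Qed.

Lemma ops_csum (R : realType) (I : eqType) (s : seq I) (f : I -> counted R) :
  ops (csum s f) = \sum_(i <- s) (ops (f i)).+1.
Proof.
rewrite /csum; elim: s 0%R => [|i s IHs] a; rewrite ?big_nil ?big_cons //=.
by rewrite IHs addn1.
Qed.

Lemma ops_cprod (R : realType) (I : eqType) (s : seq I) (f : I -> counted R) :
  ops (cprod s f) = \sum_(i <- s) (ops (f i)).+1.
Proof.
rewrite /cprod; elim: s 1%R => [|i s IHs] a; rewrite ?big_nil ?big_cons //=.
by rewrite IHs addn1.
Qed.

Lemma ops_csum_le (R : realType) (I : eqType) (s : seq I) (f : I -> counted R) c :
  (forall i, i \in s -> ops (f i) <= c) -> ops (csum s f) <= size s * c.+1.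
Proof. by move=> f_le; rewrite ops_csum leq_sum_seq_size. Qed.

Lemma ops_cprod_le (R : realType) (I : eqType) (s : seq I) (f : I -> counted R) c :
  (forall i, i \in s -> ops (f i) <= c) -> ops (cprod s f) <= size s * c.+1.
Proof. by move=> f_le; rewrite ops_cprod leq_sum_seq_size. Qed.

Lemma ops_cpow (R : realType) (x : R) n : ops (cpow x n) = n.
Proof. by elim: n => //= n ->; rewrite addn1. Qed.

Lemma ops_cfact (R : realType) n : ops (cfact R n) = n.
Proof. by elim: n => //= n ->; rewrite addn1. Qed.

Lemma ops_ccopy_map (R : realType) (s : seq R) : ops (cmap (@ccopy R) s) = size s.
Proof. by rewrite ops_cmap /= big_const_seq count_predT iter_addn_0 mul1n. Qed.

Lemma result_ccopy_map (R : realType) (s : seq R) : result (cmap (@ccopy R) s) = s.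
Proof. by rewrite result_cmap map_id. Qed.

(** * Gaussian elimination *)

Lemma gauss_size (R : realType) n (rows : seq (seq R)) :
  size (result (gauss n rows)) = n.
Proof. by elim: n rows => //= n IHn rows; rewrite IHn. Qed.

(** Eliminating one column costs O(n^2): each of at most [n] rows takes one division and two
    operations per column. Summed over the columns this is cubic, and [10] leaves room for the pivot
    copies and the back substitution. *)
Lemma ops_gauss (R : realType) n (rows : seq (seq R)) :
  all (fun row => size row <= n.+1) rows -> ops (gauss n rows) <= 10 * n ^ 3.
Proof.
elim: n rows => // n IHn rows rows_le.
have head_le : size (head [::] rows) <= n.+2.
  by case: rows rows_le => //= row rows /andP[].
(* In a column without nonzero entry, [find] returns the number of rows and [nth] falls back on the
   first row, so singular matrices obey the same bound. *)
have nth_le i : size (nth (head [::] rows) rows i) <= n.+2.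
  have [lt_i|le_i] := ltnP i (size rows); last by rewrite nth_default.
  by have /allP := rows_le; apply; apply: mem_nth.
rewrite [gauss _ _]/=; set k := find _ _.
rewrite !ops_bind !ops_ccopy_map !result_ccopy_map.
set pivot := nth _ rows k; set moved := head [::] rows in head_le *.
set rest := take n _; set red := cmap _ rest.
have pivot_le : size pivot <= n.+2 by exact: nth_le.
have rest_le row : row \in rest -> size row <= n.+2.
  have /allP set_le : all (fun row => size row <= n.+2) (set_nth [::] rows k moved).
    apply/(all_nthP [::]) => i _; rewrite nth_set_nth /=; case: eqP => // _.
    have [lt_i|le_i] := ltnP i (size rows); last by rewrite nth_default.
    by have /allP := rows_le; apply; apply: mem_nth.
  by move=> /mem_take /mem_behead /set_le.
(* The bound comes from [take], also when [set_nth] has lengthened the list for want of a pivot. *)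
have size_rest : size rest <= n by rewrite size_take_min geq_minl.
have red_ops : ops red <= n * (1 + n.+1 * 2).
  apply: leq_trans (leq_mul size_rest (leqnn _)).
  apply: ops_cmap_le => row row_in; rewrite ops_bind /= leq_add2l.
  apply: leq_trans (ops_cmap_le (c := 2) _) _ => //.
  rewrite leq_mul2r /= size_zip !size_behead.
  by apply: leq_trans (geq_minr _ _) _; lia.
have red_le : all (fun row : seq R => size row <= n.+1) (result red).
  rewrite result_cmap; apply/allP => _ /mapP[row row_in ->] /=.
  rewrite result_cmap size_map size_zip !size_behead.
  by rewrite geq_min; apply/orP; right; case: (size pivot) pivot_le.
have := IHn _ red_le; set sol := gauss n _ => sol_ops.
have csum_ops : ops (csum (zip (behead pivot) (result sol))
    (fun uv => cmul uv.1 uv.2)) <= n * 2.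
  apply: leq_trans (ops_csum_le (c := 1) _) _ => //.
  rewrite leq_mul2r /= size_zip gauss_size.
  exact: geq_minr.
rewrite /=.
move: (ops red) (ops sol) (ops (csum _ _)) (size pivot) (size moved)
  red_ops sol_ops csum_ops pivot_le head_le => a b c e f.
  rewrite !expnS !expn0 !muln1; nia.
Qed.

(** * Number and degree of the monomials of the polynomials P_k *)

Lemma leq_exp_base m n e : m <= n -> m ^ e <= n ^ e.
Proof. by case: e => // e; rewrite leq_exp2r. Qed.

(** Each occurrence of a variable contributes at most two monomials: one with an extra factor x_1,
    one with its index shifted and its degree unchanged. *)
Lemma dbar_vars_size v :
  size (dbar_vars v) <= 2 * size v /\
  {in dbar_vars v, forall m, size m.2 <= (size v).+1}.
Proof.
elim: v => [|i v [size_le deg_le]] //=; rewrite size_cat size_map; split.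
  by case: i => [|i] /=; lia.
move=> m; rewrite mem_cat => /orP[|/mapP[m' /deg_le m'_le ->]]; last by [].
by case: i => // i; rewrite !inE => /orP[] /eqP ->.
Qed.

Lemma dbar_deg q k : {in q, forall m : monomial, size m.2 <= k} ->
  {in dbar q, forall m, size m.2 <= k.+1}.
Proof.
move=> q_le m /flatten_mapP[m' /q_le m'_le].
have [_ deg_le] := dbar_vars_size m'.2.
by case: ifP => _ => [/mapP[m2 /deg_le m2_le ->]|/deg_le m2_le];
  apply: leq_trans m2_le _.
Qed.

Lemma dbar_size q k : {in q, forall m : monomial, size m.2 <= k} ->
  size (dbar q) <= size q * (2 * k).
Proof.
move=> q_le; rewrite size_flatten /shape sumnE !big_map; apply: leq_sum_seq_size.
move=> m /q_le m_le; have [size_le _] := dbar_vars_size m.2.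
by case: ifP => _; rewrite ?size_map (leq_trans size_le) // leq_mul2l.
Qed.

Lemma Ppoly_deg k : {in Ppoly k, forall m, size m.2 <= k}.
Proof.
elim: k => [|k IHk] m /=; first by rewrite inE => /eqP ->.
rewrite !mem_cat => /or3P[/mapP[m' /IHk m'_le ->]|/mapP[m' /IHk m'_le ->]|] //.
exact: dbar_deg.
Qed.

(** The products with x_1 and x_0 contribute a factor 2 and [dbar], applied to monomials of degree
    at most [k], a factor [2 * k]. *)
Lemma Ppoly_size_fact k : size (Ppoly k) <= 2 ^ k * k`!.
Proof.
elim: k => // k IHk; rewrite [Ppoly _]/= !size_cat !size_map.
have := dbar_size (@Ppoly_deg k); rewrite expnS factS.
move: (size (dbar _)) (size (Ppoly k)) (2 ^ k) (k`!) IHk => a b c e; nia.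
Qed.

(* (k+1)^(k+1) >= 2 (k+1) k^k, by the first two terms of (k+1)^k. *)
Lemma expn2_fact_le k : 2 ^ k * k`! <= 2 * k ^ k.
Proof.
elim: k => // -[//|k] IHk.
have bernoulli : 2 * k.+1 ^ k.+1 <= k.+2 ^ k.+1.
  rewrite -(addn1 k.+1) expnDn !big_ord_recl /= /bump /=.
  by rewrite !expn0 !bin0 exp1n bin1 subn0 subn1 /= !mul1n !muln1 -expnS; lia.
rewrite expnS factS [k.+2 ^ k.+2]expnS.
move: (2 ^ _) (_`!) (k.+1 ^ _) (k.+2 ^ _) IHk bernoulli => a b c e; nia.
Qed.

Lemma Ppoly_size k l : k <= l -> 0 < l -> size (Ppoly k) <= 2 * l ^ l.
Proof.
move=> le_kl l_gt0; apply: leq_trans (Ppoly_size_fact k) _.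
apply: leq_trans (expn2_fact_le k) _; rewrite leq_mul2l /=.
exact: leq_trans (leq_exp_base k le_kl) (leq_pexp2l l_gt0 le_kl).
Qed.

(** * Counting words, multi-indices and partitions *)

Section IndexSets.
Variable Y : finType.
Implicit Types (A : {set Y}) (f : {ffun Y -> nat}).

Lemma words_size A j : size (words A j) <= #|Y| ^ j.
Proof.
by rewrite size_map size_filter (leq_trans (count_size _ _)) // -cardE card_tuple.
Qed.

Lemma multi_indices_sum A s f : f \in multi_indices A s -> \sum_y f y = s.
Proof.
case/mapP => g; rewrite mem_filter => /andP[/andP[/eqP sum_g _] _] ->.
by apply: etrans sum_g; apply: eq_bigr => y _; rewrite ffunE.
Qed.

(** The word that repeats each [y] exactly [f y] times is a preimage of [f]; this is the
    surjectivity behind [multi_indices_size]. *)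
Lemma multiplicitiesK f :
  multiplicities (flatten [seq nseq (f y) y | y <- enum Y]) = f.
Proof.
apply/ffunP => y; rewrite ffunE count_flatten -map_comp sumnE big_map big_enum /=.
rewrite (bigD1 y) //= count_nseq /= eqxx mul1n big1 ?addn0 // => z z_neq.
by rewrite count_nseq /= (negPf z_neq).
Qed.

(* [multiplicities] maps the words of length s onto the multi-indices of weight s. *)
Lemma multi_indices_size A s : size (multi_indices A s) <= #|Y| ^ s.
Proof.
rewrite -card_tuple cardE -(size_map (fun w => multiplicities (tval w))).
apply: uniq_leq_size => [|f f_in].
  rewrite map_inj_in_uniq; first exact/filter_uniq/enum_uniq.
  move=> f g _ _ /ffunP eq_fg.
  by apply/ffunP => y; apply: val_inj; have := eq_fg y; rewrite !ffunE.
have size_w : size (flatten [seq nseq (f y) y | y <- enum Y]) == s.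
  rewrite size_flatten /shape -map_comp sumnE big_map big_enum /=.
  by under eq_bigr do rewrite size_nseq; rewrite (multi_indices_sum f_in).
by apply/mapP; exists (Tuple size_w); rewrite ?mem_enum ?multiplicitiesK.
Qed.

End IndexSets.

(** Partitions are selected among all functions from ['I_k] to ['I_k.+1], and this whole ambient set
    is counted. *)
Lemma partitions_size k : size (partitions k) <= k.+1 ^ k.
Proof.
rewrite size_map size_filter (leq_trans (count_size _ _)) // -cardE.
by rewrite card_ffun !card_ord.
Qed.

Lemma partitions_sum k (t : {ffun 'I_k -> nat}) :
  t \in partitions k -> \sum_i t i <= k.
Proof.
case/mapP => g; rewrite mem_filter => /andP[/eqP sum_g _] ->.
apply: leq_trans (eq_leq sum_g); apply: leq_sum => i _; rewrite ffunE.
by rewrite mulSn leq_addr.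
Qed.

Lemma mult1_le k (t : {ffun 'I_k -> nat}) : mult1 t <= \sum_i t i.
Proof.
by rewrite /mult1 [leqRHS](bigID (fun i => val i == 0)) /= leq_addr.
Qed.

Lemma rhs_args_size k (t : {ffun 'I_k -> nat}) b :
  size (rhs_args t b) <= \sum_i t i.
Proof.
rewrite size_flatten /shape -map_comp sumnE big_map big_enum /=.
by apply: leq_sum => i _; rewrite size_nseq leq_subr.
Qed.

Lemma sum_enum_set_le (Y : finType) (A : {set Y}) (f : Y -> nat) :
  \sum_(y <- enum A) f y <= \sum_y f y.
Proof.
rewrite big_enum [leqRHS](bigID (mem A)) /=.
exact: leq_addr.
Qed.

(** Over an empty source alphabet the total mass would be an empty sum, hence 0. Positivity of N
    lets costs that do not involve N be absorbed in multiples of N. *)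
Lemma source_card_gt0 (R : realType) (X Y : finType) (pb : rd_problem R X Y) :
  0 < #|X|.
Proof.
rewrite lt0n; apply/negP => /eqP X0; have := source_sum1 pb.
rewrite big_pred0 => [/eqP|x]; first by rewrite eq_sym oner_eq0.
by have := card0_eq X0 x.
Qed.

Lemma mem_zip_fst (S T : eqType) (s : seq S) (t : seq T) (u : S * T) :
  u \in zip s t -> u.1 \in s.
Proof.
elim: s t => [|x s IHs] [|y t] //; rewrite !inE => /orP[/eqP ->|/IHs ->] /=.
  by rewrite eqxx.
by rewrite orbT.
Qed.

(** * Operations at one grid point: the arrays q, E, P and G *)

Section GridPointCost.
Variables (R : realType) (X Y : finType) (pb : rd_problem R X Y) (l : nat).
Variables (beta : R) (approx : approximation R Y).

Local Notation N := #|X|.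
Local Notation M := #|Y|.
Local Notation A := (alphabet approx).
Local Notation Xs := (enum X).
Local Notation Ys := (enum A).

Lemma size_Xs : size Xs = N.
Proof. by rewrite -cardE. Qed.

Lemma size_Ys : size Ys <= M.
Proof. by rewrite -cardE max_card. Qed.

Lemma size_YXs : size (allpairs pair Ys Xs) <= M * N.
Proof. by rewrite size_allpairs size_Xs leq_mul2r size_Ys orbT. Qed.

Lemma size_kYXs (s : seq nat) :
  size (allpairs pair s (allpairs pair Ys Xs)) <= size s * (M * N).
Proof. by rewrite size_allpairs leq_mul2l size_YXs orbT. Qed.

(** Per pair: four operations for the numerator, one addition for the denominator, one division. *)
Lemma ops_compute_q : ops (compute_q pb beta approx) <= 6 * (M * N).
Proof.
rewrite /compute_q !ops_bind; set num := tabulate _ _; set den := tabulate _ _.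
have num_le : ops num <= M * N * 4.
  apply: leq_trans (leq_mul size_YXs (leqnn _)).
  exact: ops_tabulate_le.
have den_le : ops den <= N * (M * 1).
  rewrite -size_Xs; apply: ops_tabulate_le => x _.
  apply: leq_trans (ops_csum_le (c := 0) _) _ => //.
  by rewrite leq_mul2r size_Ys orbT.
apply: (@leq_trans (M * N * 4 + (N * (M * 1) + M * N * 1))); last by lia.
rewrite !leq_add //; apply: leq_trans (leq_mul size_YXs (leqnn _)).
exact: ops_tabulate_le.
Qed.

Section WithQ.
Variable q : Y -> X -> R.

Lemma ops_compute_E : ops (compute_E pb l approx q) <= 2 * l * (M * N).
Proof.
apply: leq_trans (ops_tabulate_le (c := M * 2) _) _ => [kx _|].
  apply: leq_trans (ops_csum_le (c := 1) _) _ => //.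
  by rewrite leq_mul2r size_Ys orbT.
rewrite size_allpairs size_iota size_Xs; lia.
Qed.

Lemma ops_eval_monomial E y x m : ops (eval_monomial pb E y x m) <= size m.2 + 2.
Proof.
rewrite /eval_monomial !ops_bind leq_add //; last by case: ifP.
apply: leq_trans (ops_cprod_le (c := 0) _) _ => //.
by rewrite muln1 size_filter count_size.
Qed.

Lemma ops_compute_P E : 0 < l ->
  ops (compute_P pb l approx E) <= 6 * (M * N * l.+1 ^ l.+2).
Proof.
move=> l_gt0.
(* [2 * l.+1 ^ l] bounds the number of monomials, [l + 3] the cost of evaluating one and adding
   it. *)
apply: leq_trans (ops_tabulate_le (c := 2 * l.+1 ^ l * (l + 3)) _) _.
  move=> [k [y x]] /allpairsP[[k' yx] /= [k_in _ [-> _]]].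
  have le_kl : k' <= l by move: (k_in : k' \in iota 0 l.+1); rewrite mem_iota.
  apply: leq_trans (ops_csum_le (c := l + 2) _) _ => [m m_in|].
    apply: leq_trans (ops_eval_monomial _ _ _ _) _.
    by rewrite leq_add2r (leq_trans (Ppoly_deg m_in)).
  rewrite -addnS leq_mul // (leq_trans (Ppoly_size le_kl l_gt0)) // leq_mul2l /=.
  exact: leq_exp_base.
apply: leq_trans (leq_mul (size_kYXs _) (leqnn _)) _; rewrite size_iota.
rewrite !expnS; move: (l.+1 ^ l) (M * N) => a b; nia.
Qed.

(** Each of at most [l.+1 ^ l] partitions costs O(l^2): the factorials of the parts cost at most [k]
    each, all the powers together [\sum_i t i <= k], and updating the [l.+2] entries of the row at
    most [l + 3] each. *)
Lemma ops_G_row P k y x : k <= l ->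
  ops (@G_row R X Y l P k y x) <= l.+1 ^ l * (7 * l.+1 ^ 2).
Proof.
move=> le_kl; rewrite /G_row.
apply: leq_trans (@ops_cfold_le {ffun 'I_k -> nat} (seq R) _ _ _ (7 * l.+1 ^ 2) _) _;
  last first.
  rewrite leq_mul2r (leq_trans (partitions_size k)) ?orbT //.
  by apply: leq_trans (leq_exp_base k _) (leq_pexp2l (ltn0Sn l) le_kl).
move=> row t /partitions_sum t_le; rewrite !ops_bind.
set num := ops (cprod _ _); set den := ops (cprod _ _); set out := ops (cmap _ _).
have num_le : num <= k * (k + 3) + \sum_i t i.
  rewrite /num ops_cprod big_enum.
  under eq_bigr do rewrite !ops_bind ops_cfact ops_cpow /= addnA -addnS.
  apply: leq_trans (_ : \sum_(i in 'I_k) (k + 3 + t i) <= _).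
    apply: leq_sum => i _; move: (nat_of_ord i) (t i) (ltn_ord i) => a b lt_ak; lia.
  by rewrite big_split /= sum_nat_const card_ord.
have den_le : den <= k + \sum_i t i.
  rewrite /den ops_cprod big_enum.
  under eq_bigr do rewrite ops_cfact -add1n.
  by rewrite big_split /= sum_nat_const card_ord muln1.
have out_le : out <= l.+2 * (l + 3).
  apply: leq_trans (ops_cmap_le (c := l + 3) _) _ => [av|].
    move=> /mem_zip_fst; rewrite mem_iota add0n => /= av_lt.
    by case: ifP => // _; rewrite !ops_bind ops_cfact /=; lia.
  by rewrite leq_mul2r size_zip size_iota geq_minl orbT.
rewrite /=; move: num den out (\sum_i t i) num_le den_le out_le t_le => a b c e.
rewrite expnS expn1; nia.
Qed.

Lemma ops_compute_G P :
  ops (@compute_G R X Y l approx P) <= 7 * (M * N * l.+1 ^ l.+3).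
Proof.
apply: leq_trans (ops_tabulate_le (c := l.+1 ^ l * (7 * l.+1 ^ 2)) _) _.
  move=> [k [y x]] /allpairsP[[k' yx] /= [k_in _ [-> _]]].
  by apply: ops_G_row; move: (k_in : k' \in iota 0 l.+1); rewrite mem_iota.
apply: leq_trans (leq_mul (size_kYXs _) (leqnn _)) _; rewrite size_iota.
rewrite !expnS expn0; move: (l.+1 ^ l) (M * N) => a b; nia.
Qed.

(** * Operations for the derivative tensors *)

Section Tensors.
Variables (P : nat -> Y -> X -> R) (G : nat -> nat -> Y -> X -> R).

Lemma ops_beta_entry b y : ops (beta_entry pb approx q P b y) <= 4 * N.
Proof.
have := source_card_gt0 pb; rewrite /beta_entry ops_bind.
set s := csum _ _ => N_gt0; have s_le : ops s <= N * 3.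
  by rewrite -size_Xs; apply: ops_csum_le => x _; case: (b).
by case: (b) => [|b'] /=; move: (ops s) #|X| s_le N_gt0 => c n; lia.
Qed.

(** [M ^ b] bounds the number of ways to distribute the [b] differentiations in beta over the
    alphabet. Factorials and powers are linear in [M + j] because [al] has weight [j]. *)
Lemma ops_mixed_entry b j al y : 0 < M -> al \in multi_indices A j ->
  ops (mixed_entry pb approx q G b al y) <= 22 * (N * M ^ b * (M + j + b)).
Proof.
move=> M_gt0 /multi_indices_sum al_sum.
have N_gt0 := source_card_gt0 pb; have Mb_gt0 : 0 < M ^ b by rewrite expn_gt0 M_gt0.
have Ys_le := size_Ys.
have al_le : \sum_(z <- Ys) al z <= j by rewrite -al_sum sum_enum_set_le.
rewrite /mixed_entry !ops_bind !ops_cpow !ops_cfact al_sum.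
set fal := ops (cprod _ _); set s := ops (csum _ _).
have fal_le : fal <= M + j.
  rewrite /fal ops_cprod; under eq_bigr do rewrite ops_cfact -add1n.
  rewrite big_split /= leq_add // (leq_trans (leq_sum_seq_size (c := 1) _)) //.
  by rewrite muln1.
have s_le : s <= N * (2 * M + j + M ^ b * (M + 8) + 2).+1.
  rewrite -size_Xs; apply: ops_csum_le => x _.
  rewrite !ops_bind; set w := ops (cprod _ _); set g := ops (csum _ _).
  have w_le : w <= 2 * M + j.
    rewrite /w ops_cprod.
    under eq_bigr do rewrite ops_bind ops_cpow /= add1n -add2n.
    rewrite big_split /= leq_add // (leq_trans (leq_sum_seq_size (c := 2) _)) //.
    by rewrite mulnC leq_mul2l.
  (* The [8] counts five operations for [u1] to [u5], the bracket, the product with it, and the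
     addition to the sum. *)
  have g_le : g <= M ^ b * (M + 8).
    apply: leq_trans (leq_mul (multi_indices_size A b) (leqnn _)).
    rewrite [M + 8]addnS; apply: ops_csum_le => k _; rewrite !ops_bind /=.
    set o := ops (cprod _ _); have o_le : o <= M * 1.
      apply: leq_trans (ops_cprod_le (c := 0) _) _ => //.
      rewrite leq_mul2r (leq_trans _ Ys_le) ?orbT // size_filter count_size //.
    by move: o M o_le => c m; lia.
  rewrite /=; move: w g (M ^ b * _) (2 * M) w_le g_le => w1 g1 G1 m w1_le g1_le.
  by lia.
rewrite /=; move: fal s M (M ^ b) Mb_gt0 fal_le s_le M_gt0 => a c m W.
move: N N_gt0 => n *.
have : n * W * (m + j + b) >= n * W * m by rewrite leq_mul2l; lia.
nia.
Qed.

(** About [M ^ j.+1] entries at a cost of order [M ^ b] each yield a power that depends only on the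
    total order [b + j]. The copies are absorbed by raising the constant from [22] to [23]. *)
Lemma ops_tensor b j : 0 < M ->
  ops (tensor pb approx q P G b j) <= 23 * (N * M ^ (b + j).+1 * (M + (b + j))).
Proof.
move=> M_gt0; have N_gt0 := source_card_gt0 pb.
have Mb_gt0 e : 0 < M ^ e by rewrite expn_gt0 M_gt0.
case: j => [|j].
  apply: leq_trans (ops_tabulate_le (c := 4 * N) _) _ => [byw _|].
    exact: ops_beta_entry.
  rewrite size_map addn0 expnS; apply: leq_trans (leq_mul size_Ys (leqnn _)) _.
  move: N M (M ^ b) (Mb_gt0 b) M_gt0 N_gt0 => n m W W_gt0 m_gt0 n_gt0.
  have : n * m * 1 <= n * m * (W * (m + b)) by rewrite leq_mul2l muln_gt0 W_gt0; lia.
  by nia.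
rewrite /tensor; move: j.+1 (ltn0Sn j) => {}j j_gt0; rewrite ops_bind.
set entries := tabulate _ _.
have entries_le : ops entries <= M * M ^ j * (22 * (N * M ^ b * (M + j + b))).
  apply: leq_trans (ops_tabulate_le (c := 22 * (N * M ^ b * (M + j + b))) _) _.
    by move=> yal /allpairsP[[y al] /= [_ al_in ->]]; apply: ops_mixed_entry.
  by rewrite leq_mul2r size_allpairs leq_mul ?size_Ys ?multi_indices_size ?orbT.
have copy_le : ops (tabulate [seq (b, yw) | yw <- allpairs pair Ys (words A j)]
    (fun byw => ccopy (read 0%R (result entries)
      (byw.2.1, multiplicities byw.2.2)))) <= M * M ^ j.
  apply: leq_trans (ops_tabulate_le (c := 1) _) _ => //.
  by rewrite muln1 size_map size_allpairs leq_mul ?size_Ys ?words_size.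
apply: leq_trans (leq_add entries_le copy_le) _; rewrite expnS expnD.
move: N M (M ^ b) (M ^ j) (Mb_gt0 b) M_gt0 N_gt0 => n m W V W_gt0 m_gt0 n_gt0.
have : m * V * 1 <= m * V * (n * W * (m + j + b)).
  by rewrite leq_mul2l !muln_gt0 n_gt0 W_gt0; lia.
by nia.
Qed.

Lemma ops_tensors m : 0 < M ->
  ops (tensors pb approx q P G m) <= 23 * (m.+1 * (N * M ^ m.+1 * (M + m))).
Proof.
move=> M_gt0; rewrite /tensors ops_bind addn0.
apply: leq_trans (ops_cmap_le (c := 23 * (N * M ^ m.+1 * (M + m))) _) _.
  move=> b; rewrite mem_iota add0n ltnS => /= le_bm.
  by have := ops_tensor b (m - b) M_gt0; rewrite subnKC.
by rewrite size_iota mulnCA.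
Qed.

End Tensors.
End WithQ.

(** * Operations for the right-hand sides and the linear systems *)

Section ImplicitDerivatives.
Variables (T : nat -> Y -> seq Y -> R) (dr : nat -> Y -> R).

Lemma ops_multilinear b args y :
  ops (multilinear approx T dr b args y) <= M ^ size args * (size args + 2).
Proof.
apply: leq_trans (ops_csum_le (c := size args + 1) _) _ => [w _|].
  rewrite ops_bind leq_add //; apply: leq_trans (ops_cprod_le (c := 0) _) _ => //.
  by rewrite muln1 size_zip geq_minl.
by rewrite addn1 addn2 leq_mul2r words_size orbT.
Qed.

Lemma ops_rhs_coef k (t : {ffun 'I_k -> nat}) b :
  t \in partitions k -> b <= mult1 t -> ops (rhs_coef R t b) <= 4 * k.+1 ^ 2.
Proof.
move=> /partitions_sum t_le b_le; have m1_le := leq_trans (mult1_le t) t_le.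
rewrite /rhs_coef !ops_bind !ops_cfact.
set f3 := ops (cprod _ _); set f4 := ops (cprod _ _).
have f3_le : f3 <= k + \sum_i t i.
  rewrite /f3 ops_cprod big_filter big_enum_cond.
  under eq_bigr do rewrite ops_cfact -add1n.
  apply: leq_trans (_ : \sum_(i in 'I_k) (1 + t i) <= _).
    by rewrite [leqRHS](bigID (fun i => val i != 0)) leq_addr.
  by rewrite big_split /= sum_nat_const card_ord muln1.
have f4_le : f4 <= k * (k + 1) + \sum_i t i.
  rewrite /f4 ops_cprod big_enum.
  under eq_bigr do rewrite ops_bind ops_cfact ops_cpow -addnS.
  apply: leq_trans (_ : \sum_(i in 'I_k) (k + 1 + t i) <= _).
    by apply: leq_sum => i _; move: (nat_of_ord i) (t i) (ltn_ord i) => a c a_lt; lia.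
  by rewrite big_split /= sum_nat_const card_ord.
rewrite /=; move: (mult1 t) f3 f4 (\sum_i t i) b_le m1_le f3_le f4_le t_le.
move=> m f g s; rewrite expnS expn1; nia.
Qed.

(** There are at most [k.+1 ^ k.+1] terms: [k.+1 ^ k] partitions with at most [k.+1] values of [b]
    each. The first summand pays for their coefficients, computed once for all components; the
    second for the multilinear forms, which have at most [k] arguments and are evaluated for each of
    the at most M components. *)
Lemma ops_rhs k : 0 < M -> 0 < k ->
  ops (rhs approx T dr k) <= 4 * k.+1 ^ k.+3 + 5 * (M ^ k.+1 * k.+1 ^ k.+2).
Proof.
move=> M_gt0 k_gt0; have Mk_gt0 e : 0 < M ^ e by rewrite expn_gt0 M_gt0.
rewrite /rhs; case: eqP => [->|_].
  apply: leq_trans (ops_cmap_le (c := 1) _) _ => //.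
  rewrite muln1 (leq_trans size_Ys) //.
  by rewrite !expnS expn0; move: M M_gt0 => m m_gt0; nia.
set pairs := [seq _ | t <- _, b <- _].
have pairs_in t b : (t, b) \in pairs -> t \in partitions k /\ b <= mult1 t.
  case/allpairsPdep => t' [b' [t'_in b'_in [-> ->]]].
  by move: t'_in b'_in; rewrite mem_filter mem_iota ltnS => /andP[_ ->].
have size_pairs : size pairs <= k.+1 ^ k.+1.
  rewrite size_allpairs_dep sumnE big_map.
  apply: leq_trans (leq_sum_seq_size (c := k.+1) _) _ => [t|].
    rewrite mem_filter size_iota ltnS => /andP[_ /partitions_sum].
    exact: leq_trans (mult1_le t).
  rewrite expnS mulnC leq_mul2l size_filter (leq_trans (count_size _ _)) //.
  exact: partitions_size.
rewrite ops_bind; set terms := cmap _ pairs.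
have terms_ops : ops terms <= k.+1 ^ k.+1 * (4 * k.+1 ^ 2).
  apply: leq_trans (leq_mul size_pairs (leqnn _)).
  apply: ops_cmap_le => -[t b] /pairs_in[t_in b_le].
  by rewrite ops_bind addn0; apply: ops_rhs_coef.
set out := cmap _ _.
have out_ops : ops out <= M * (k.+1 ^ k.+1 * (M ^ k * (k + 2) + 1).+1 + 1).
  apply: leq_trans (leq_mul size_Ys (leqnn _)).
  apply: ops_cmap_le => y _; rewrite ops_bind leq_add //.
  apply: leq_trans (leq_mul size_pairs (leqnn _)).
  have -> : size pairs = size (result terms) by rewrite result_cmap size_map.
  apply: ops_csum_le => term; rewrite result_cmap => /mapP[[t b]].
  case/pairs_in => /partitions_sum t_le _ ->; rewrite ops_bind leq_add //.
  apply: leq_trans (ops_multilinear _ _ _) _.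
  have size_le := leq_trans (rhs_args_size t b) t_le.
  by rewrite leq_mul ?leq_add2r //; apply: leq_pexp2l.
apply: leq_trans (leq_add terms_ops out_ops) _.
have -> : k.+1 ^ k.+3 = k.+1 ^ k.+1 * k.+1 ^ 2 by rewrite -expnD addn2.
rewrite [k.+1 ^ k.+2]expnS [M ^ k.+1]expnS mulnCA leq_add2l.
have : 0 < k.+1 ^ k.+1 by rewrite expn_gt0.
move: (k.+1 ^ k.+1) M (M ^ k) (Mk_gt0 k) M_gt0 => Q m W W_gt0 m_gt0 Q_gt0.
rewrite -!mulnA mulnCA leq_mul2l.
have : Q * 1 <= Q * W by rewrite leq_mul2l; lia.
by nia.
Qed.

(** Copying the augmented matrix costs at most [M * M.+1 <= 2 * M ^ 3], which joins the [10 * M ^ 3]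
    of the elimination. *)
Lemma ops_implicit_derivative k : 0 < M -> 0 < k ->
  ops (implicit_derivative approx T dr k)
  <= 4 * k.+1 ^ k.+3 + 5 * (M ^ k.+1 * k.+1 ^ k.+2) + 12 * M ^ 3.
Proof.
move=> M_gt0 k_gt0; rewrite /implicit_derivative ops_bind leq_add ?ops_rhs // !ops_bind.
set rows := cmap _ _; rewrite addn0.
have rows_ops : ops rows <= M * M.+1.
  apply: leq_trans (ops_cmap_le (c := M.+1) _) _ => [yb _|].
    by rewrite ops_ccopy_map size_rcons size_map ltnS size_Ys.
  rewrite leq_mul2r size_zip (leq_trans (geq_minl _ _)) ?size_Ys ?orbT //.
have rows_le : all (fun row => size row <= (size Ys).+1) (result rows).
  rewrite result_cmap; apply/allP => _ /mapP[yb _ ->].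
  by rewrite result_ccopy_map size_rcons size_map.
have gauss_le := leq_trans (ops_gauss rows_le) _.
have {gauss_le}gauss_le : ops (gauss (size Ys) (result rows)) <= 10 * M ^ 3.
  by apply: gauss_le; rewrite leq_mul2l /= leq_exp_base ?size_Ys.
apply: leq_trans (leq_add rows_ops gauss_le) _.
by rewrite !expnS expn0; move: M M_gt0 => m m_gt0; nia.
Qed.

End ImplicitDerivatives.

(** All bounds increase with [k], so [k] is replaced by [l] to make the stages uniform; the cubic
    cost of the elimination fits in [M ^ l.+2] since [l] is positive. *)
Lemma ops_derivative_stage q P G st k : 0 < M -> 0 < k -> k <= l ->
  ops (derivative_stage pb l approx q P G st k)
  <= 40 * (N * (l.+1 ^ l.+3 + M ^ l.+1 * l.+1 ^ l.+2 + l.+1 * M ^ l.+2)).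
Proof.
move=> M_gt0 k_gt0 le_kl; have N_gt0 := source_card_gt0 pb.
apply: (@leq_trans (23 * (k.+1 * (N * M ^ k.+1 * (M + k)))
  + (4 * k.+1 ^ k.+3 + 5 * (M ^ k.+1 * k.+1 ^ k.+2) + 12 * M ^ 3))).
  apply: ops_bind_le; first exact: ops_tensors.
  by rewrite -[leqRHS]addn0; apply: ops_bind_le => //; apply: ops_implicit_derivative.
have Mk_le : M ^ k.+1 <= M ^ l.+1 by rewrite leq_pexp2l.
have lk_le e : k.+1 ^ (k + e) <= l.+1 ^ (l + e).
  apply: leq_trans (leq_exp_base _ (_ : _ <= l.+1)) _ => //.
  by rewrite leq_pexp2l // leq_add2r.
have := lk_le 3; have := lk_le 2; rewrite !addn2 !addn3 => lk2_le lk3_le.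
have M3_le : M ^ 3 <= M ^ l.+2 by rewrite leq_pexp2l // !ltnS (leq_trans k_gt0).
have Mlk_le : M ^ k.+1 * k.+1 ^ k.+2 <= M ^ l.+1 * l.+1 ^ l.+2 by exact: leq_mul.
(* The factor [M + k] is split: its part [M] raises the power of M, while its part [k] joins [k.+1]
   and [l.+1 ^ 2 <= l.+1 ^ l.+2]. *)
have tens_le : k.+1 * (N * M ^ k.+1 * (M + k))
    <= N * (l.+1 * M ^ l.+2 + M ^ l.+1 * l.+1 ^ l.+2).
  have l2_le : l.+1 ^ 2 <= l.+1 ^ l.+2 by rewrite leq_pexp2l.
  apply: leq_trans (_ : l.+1 * (N * M ^ l.+1 * (M + l.+1)) <= _).
    by rewrite !leq_mul ?leq_add // leqW.
  rewrite [M ^ l.+2]expnS.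
  move: N M l.+1 (M ^ l.+1) (l.+1 ^ l.+2) l2_le => n m L W V; rewrite !expnS expn0 => ?.
  have : n * W * (L * (L * 1)) <= n * W * V by rewrite leq_mul2l; lia.
  by nia.
move: tens_le Mlk_le lk3_le M3_le.
move: (k.+1 * _) (M ^ l.+1 * _) (M ^ k.+1 * _) (k.+1 ^ k.+3) (l.+1 ^ l.+3).
move: (M ^ 3) (M ^ l.+2) N N_gt0 => a1 a2 n n_gt0 b1 b2 b3 b4 b5 h1 h2 h3 h4.
have h5 : l.+1 * a2 >= a2 by rewrite leq_pmull.
move: (l.+1 * a2) h1 h5 => a3 h1 h5.
have h6 : 1 * (b5 + b2 + a3) <= n * (b5 + b2 + a3) by rewrite leq_mul2r; lia.
by nia.
Qed.

(* The three terms come from the coefficients and the arrays P and G, from the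
   multilinear forms in the right-hand sides, and from the derivative tensors. *)
Definition grid_cost (n m k : nat) : nat :=
  n * (m * k.+1 ^ k.+4 + m ^ k.+1 * k.+1 ^ k.+3 + k.+1 ^ 2 * m ^ k.+2).

(** Every summand is a multiple of a quantity below the single cost [B]; the multiples 6, 2, 6, 7,
    23 and 40 add up to 84. *)
Lemma ops_grid_point : 0 < l ->
  ops (grid_point pb l beta approx) <= 100 * grid_cost N M l.
Proof.
move=> l_gt0; have M_gt0 := reproduction_gt0 pb.
set stage := 40 * (N * (l.+1 ^ l.+3 + M ^ l.+1 * l.+1 ^ l.+2 + l.+1 * M ^ l.+2)).
apply: (@leq_trans (6 * (M * N) + (2 * l * (M * N)
    + (6 * (M * N * l.+1 ^ l.+2) + (7 * (M * N * l.+1 ^ l.+3)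
    + (23 * (1 * (N * M ^ 1 * (M + 0))) + (l * stage + 0))))))).
  apply: ops_bind_le; first exact: ops_compute_q.
  apply: ops_bind_le; first exact: ops_compute_E.
  apply: ops_bind_le; first exact: ops_compute_P.
  apply: ops_bind_le; first exact: ops_compute_G.
  apply: ops_bind_le; first exact: ops_tensors.
  apply: ops_bind_le => //; rewrite -[in leqRHS](size_iota 1 l).
  apply: ops_cfold_le => st k; rewrite mem_iota add1n ltnS => /andP[k_gt0 le_kl].
  exact: ops_derivative_stage.
have M2_le : M ^ 2 <= l.+1 ^ 2 * M ^ l.+2.
  by rewrite -[leqLHS]mul1n leq_mul ?expn_gt0 // leq_pexp2l.
rewrite {}/stage /grid_cost expn1 addn0.
rewrite [l.+1 ^ l.+4]expnS [l.+1 ^ l.+3]expnS.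
have : l.+1 <= l.+1 ^ l.+2 by rewrite -[leqLHS]expn1 leq_pexp2l.
move: M2_le; rewrite [M ^ 2]expnS expn1 [l.+1 ^ 2]expnS expn1.
move: (ltn0Sn l) (leqnSn l).
move: N M l.+1 (M ^ l.+1) (M ^ l.+2) (l.+1 ^ l.+2) M_gt0.
move=> n m s W V L m_gt0 s_gt0 le_ls h1 h2.
pose B := n * (m * (s * (s * L)) + W * (s * L) + s * s * V); rewrite -/B.
(* The number of stages is at most [s], the abstracted [l.+1], which supplies the extra factor [s]
   in every term of [B]. *)
have stage_le : l * (40 * (n * (s * L + W * L + s * V))) <= 40 * B.
  rewrite mulnCA leq_mul2l /= mulnCA leq_mul2l; apply/orP; right.
  apply: leq_trans (leq_mul le_ls (leqnn _)) _; rewrite !mulnDr mulnA.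
  by rewrite -[s * s * V]mulnA [s * (W * L)]mulnCA !leq_add // -mulnA leq_pmull.
have B1 : m * n * (s * (s * L)) <= B.
  by rewrite [m * n]mulnC -mulnA leq_mul2l -addnA leq_addr orbT.
have B2 : n * m * m <= B.
  by rewrite -mulnA leq_mul2l (leq_trans h1) ?leq_addl ?orbT.
have h3 : m * n * (s * L) <= B.
  by apply: leq_trans B1; rewrite leq_mul2l leq_pmull ?orbT.
have h4 : m * n * L <= B by apply: leq_trans h3; rewrite leq_mul2l leq_pmull ?orbT.
have h5 : m * n * s <= B by apply: leq_trans h4; rewrite leq_mul2l h2 orbT.
have h6 : m * n * l <= B by apply: leq_trans h5; rewrite leq_mul2l le_ls orbT.
have h7 : m * n <= B by apply: leq_trans h5; rewrite leq_pmulr.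
move: h3 h4 stage_le h6 h7 B2; rewrite -[2 * l * _]mulnA [l * (m * n)]mulnC mul1n.
move: (m * n) (m * n * (s * L)) (m * n * L) (m * n * l) (n * m * m) (l * (40 * _)).
by clearbody B => *; lia.
Qed.

(** * Taylor steps and the whole grid *)

Lemma ops_taylor_step step drs :
  ops (taylor_step l approx step drs) <= 5 * (M * l.+1 ^ 2).
Proof.
apply: leq_trans (ops_tabulate_le (c := 5 * l.+1 ^ 2) _) _ => [y _|].
  rewrite ops_bind; apply: (@leq_trans (l * (2 * l + 2).+1 + 1)); last first.
    by rewrite expnS expn1; nia.
  rewrite leq_add //; apply: leq_trans (ops_csum_le (c := 2 * l + 2) _) _.
    move=> k; rewrite mem_iota add1n ltnS => /andP[_ le_kl].
    by rewrite !ops_bind ops_cpow ops_cfact /=; lia.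
  by rewrite size_iota.
by apply: leq_trans (leq_mul size_Ys (leqnn _)) _; rewrite mulnCA.
Qed.

End GridPointCost.

(** The constant adds [5] for a Taylor step to the [100] of a grid point. The bounds depend on the
    alphabets only through their full cardinalities, so the induction holds for whatever
    approximation the handler returns. *)
Lemma root_tracking_cost (R : realType) (X Y : finType) (pb : rd_problem R X Y)
    (l : nat) (handler : bifurcation_handler R Y) (grid : seq R)
    (a : approximation R Y) : 0 < l ->
  computational_complexity pb l handler grid a
  <= size grid * (105 * grid_cost #|X| #|Y| l).
Proof.
move=> l_gt0; rewrite /computational_complexity.
have step_le (a' : approximation R Y) step drs :
    ops (taylor_step l a' step drs) <= 5 * grid_cost #|X| #|Y| l.
  apply: leq_trans (ops_taylor_step l a' step drs) _; rewrite leq_mul2l /= /grid_cost.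
  apply: (@leq_trans (#|Y| * l.+1 ^ l.+4)); first by rewrite leq_mul2l leq_pexp2l ?orbT.
  apply: leq_trans (leq_pmull _ (source_card_gt0 pb)).
  by rewrite -addnA leq_addr.
elim: grid a => [|beta [|beta' grid] IHgrid] a //.
  apply: (@leq_trans (100 * grid_cost #|X| #|Y| l + 0)).
    by apply: ops_bind_le => //; apply: ops_grid_point.
  by rewrite mul1n; lia.
apply: (@leq_trans (100 * grid_cost #|X| #|Y| l + (5 * grid_cost #|X| #|Y| l
    + (size (beta' :: grid) * (105 * grid_cost #|X| #|Y| l) + 0)))).
  apply: ops_bind_le; first exact: ops_grid_point.
  apply: ops_bind_le; first exact: step_le.
  by apply: ops_bind_le => //; apply: IHgrid.
by rewrite addn0 addnA -mulnDl -mulSn.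
Qed.

(** * Memory at a grid point and along the grid *)

Lemma geometric_sum_le m k : 0 < m ->
  \sum_(b < k.+1) m ^ (k - b).+1 <= k.+1 + 2 * m ^ k.+1.
Proof.
(* For [m = 1] all terms are one, which accounts for the summand [k.+1]; for larger [m] the sum is
   geometric and at most twice its first term. *)
case: m => [|[|m]] // _.
  under eq_bigr do rewrite exp1n.
  by rewrite sum_nat_const card_ord exp1n muln1 leq_addr.
apply: leq_trans (leq_addl _ _); elim: k => [|k IHk].
  by rewrite big_ord_recl big_ord0 subn0 addn0; apply: leq_pmull.
rewrite big_ord_recl subn0 (eq_bigr (fun b : 'I_k.+1 => m.+2 ^ (k - b).+1)) //=.
by move: IHk; rewrite [m.+2 ^ k.+2]expnS; move: (\sum_(b < _) _) (_ ^ _) => s e; nia.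
Qed.

(** With [l = k.+1], this counts the stages that memorize their tensors: all but the last. *)
Lemma count_iota_lt k : count (fun i => i < k.+1) (iota 1 k.+1) = k.
Proof.
rewrite -[in iota _ _](addn1 k) iotaD count_cat add1n /= ltnn !addn0.
rewrite (@eq_in_count _ _ predT) => [|i]; first by rewrite count_predT size_iota.
by rewrite mem_iota add1n => /andP[].
Qed.

Section GridPointMemory.
Variables (R : realType) (X Y : finType) (pb : rd_problem R X Y) (l : nat).
Variables (beta : R) (approx : approximation R Y).

Local Notation N := #|X|.
Local Notation M := #|Y|.
Local Notation A := (alphabet approx).

Lemma size_G_row P k y x : size (result (@G_row R X Y l P k y x)) <= l.+2.
Proof.
apply: (@cfold_ind _ _ (fun row : seq R => size row <= l.+2)).
  by rewrite size_nseq.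
move=> row t _; rewrite !result_bind result_cmap size_map size_zip size_iota.
exact: geq_minl.
Qed.

Lemma size_compute_G P :
  sumn [seq size kv.2 | kv <- result (@compute_G R X Y l approx P)]
  <= l.+1 * (M * N) * l.+2.
Proof.
rewrite sumnE big_map.
apply: leq_trans (leq_sum_seq_size (c := l.+2) _) _ => [kv|].
  by rewrite result_tabulate => /mapP[kyx _ ->]; apply: size_G_row.
by rewrite leq_mul2r size_tabulate (leq_trans (size_kYXs _ _ _)) ?size_iota ?orbT.
Qed.

Variables (q : Y -> X -> R) (P : nat -> Y -> X -> R) (G : nat -> nat -> Y -> X -> R).

Lemma size_tensor b j :
  size (result (tensor pb approx q P G b j)) <= M ^ j.+1.
Proof.
case: j => [|j]; rewrite /tensor ?result_bind size_tabulate size_map ?size_Ys //.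
by rewrite size_allpairs expnS leq_mul ?size_Ys ?words_size.
Qed.

Lemma size_tensors m : 0 < M ->
  size (result (tensors pb approx q P G m)) <= m.+1 + 2 * M ^ m.+1.
Proof.
move=> /(geometric_sum_le m); apply: leq_trans.
rewrite /tensors result_bind size_flatten result_cmap /shape -map_comp sumnE big_map.
rewrite -[iota 0 m.+1]/(index_iota 0 m.+1) big_mkord.
by apply: leq_sum => b _; apply: size_tensor.
Qed.

Lemma size_memo st s : 0 < M ->
  size (result (cfold (derivative_stage pb l approx q P G) st s)).1
  <= size st.1 + count (fun k => k < l) s * (l + 2 * M ^ l).
Proof.
move=> M_gt0; elim: s st => [|k s IHs] st; first by rewrite addn0.
apply: leq_trans (IHs _) _; rewrite [count _ (k :: s)]/= mulnDl addnA leq_add2r /=.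
case: ltnP => lt_kl; last by rewrite addn0.
rewrite size_cat mul1n leq_add2l (leq_trans (size_tensors _ M_gt0)) //.
by rewrite leq_add // leq_mul2l leq_pexp2l.
Qed.

End GridPointMemory.

(** The arrays E, P and G take at most 1, 2 and 6 times [M * N * l ^ 2]. The tenth multiple absorbs
    the [l * l] left by the memorized tensors, as [M * N] is at least 1. *)
Lemma grid_memory_le (R : realType) (X Y : finType) (pb : rd_problem R X Y)
    (l : nat) (beta : R) (approx : approximation R Y) : 0 < l ->
  grid_memory (result (grid_point pb l beta approx))
  <= 10 * (#|Y| * #|X| * l ^ 2) + 2 * (#|Y| ^ l * l).
Proof.
move=> l_gt0; have M_gt0 := reproduction_gt0 pb; have N_gt0 := source_card_gt0 pb.
rewrite /grid_memory.
have E_le : size (E_array (result (grid_point pb l beta approx))) <= l * #|X|.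
  by rewrite size_tabulate size_allpairs size_iota size_Xs.
have P_le : size (P_array (result (grid_point pb l beta approx)))
    <= l.+1 * (#|Y| * #|X|).
  by rewrite size_tabulate (leq_trans (size_kYXs _ _ _)) ?size_iota.
have G_le : sumn [seq size kv.2 | kv <- G_array (result (grid_point pb l beta approx))]
    <= l.+1 * (#|Y| * #|X|) * l.+2.
  exact: size_compute_G.
have memo_le : size (memo (result (grid_point pb l beta approx)))
    <= l * (l + 2 * #|Y| ^ l).
  apply: leq_trans (size_memo _ _ _ _ _ _ _ _ M_gt0) _.
  apply: leq_trans (leq_add (size_tensors _ _ _ _ _ 0 M_gt0) (leqnn _)) _.
  (* The loop memorizes [l - 1] orders; with order zero, computed before it, there are [l]
     summands. *)
  rewrite -[in count _ _](prednK l_gt0) count_iota_lt.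
  rewrite -[X in _ <= X * _](prednK l_gt0) mulSn leq_add2r leq_add //.
  by rewrite mul1n addnn -mul2n leq_mul2l leq_pexp2l.
apply: leq_trans (leq_add (leq_add (leq_add E_le P_le) G_le) memo_le) _.
rewrite expnS expn1; move: (#|Y|) (#|X|) (_ ^ l) M_gt0 N_gt0 => m n W m_gt0 n_gt0.
have h1 : 1 * n <= m * n by rewrite leq_mul2r; lia.
have h2 : 1 <= m * n by rewrite muln_gt0 m_gt0.
move: (m * n) h1 h2 => B h1 h2.
have h3 : l * 1 <= l * l by rewrite leq_mul2l l_gt0 orbT.
have h4 : B * l <= B * (l * l) by rewrite leq_mul2l; lia.
have h5 : B * 1 <= B * (l * l) by rewrite leq_mul2l; lia.
have h6 : 1 * (l * l) <= B * (l * l) by rewrite leq_mul2r h2 orbT.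
have h7 : l * n <= B * l by rewrite mulnC leq_mul2r; lia.
nia.
Qed.

Lemma max_grid_memory_le (R : realType) (X Y : finType) (pb : rd_problem R X Y)
    (l : nat) (handler : bifurcation_handler R Y) (grid : seq R)
    (a : approximation R Y) : 0 < l ->
  \max_(g <- result (root_tracking pb l handler grid a)) grid_memory g
  <= 10 * (#|Y| * #|X| * l ^ 2) + 2 * (#|Y| ^ l * l).
Proof.
move=> l_gt0.
elim: grid a => [|beta [|beta' grid] IHgrid] a; first by rewrite big_nil.
  by rewrite big_seq1 grid_memory_le.
set g := grid_point pb l beta a.
set a' := handler beta' (alphabet a) (read 0%R
  (result (taylor_step l a (beta' - beta)%R (derivatives (result g))))).
have -> : result (root_tracking pb l handler [:: beta, beta' & grid] a)
    = result g :: result (root_tracking pb l handler (beta' :: grid) a') by [].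
by rewrite big_cons geq_max grid_memory_le ?IHgrid.
Qed.

(** * From the grid cost to the powers in the claim *)

Lemma grid_cost_le n m l : 0 < m -> 1 < l ->
  grid_cost n m l <= 3 * (n * (m + l) ^ (3 * l + 2)).
Proof.
move=> m_gt0 l_gt1; rewrite /grid_cost mulnCA leq_mul2l; apply/orP; right.
(* In the common base [m + l] the three terms have exponents [l + 5], [2 * l + 4] and [l + 4]. That
   the second is at most [3 * l + 2] amounts to [2 <= l]. *)
have le_mS e : m ^ e <= (m + l) ^ e by rewrite leq_exp_base ?leq_addr.
have le_lS e : l.+1 ^ e <= (m + l) ^ e by rewrite leq_exp_base // -add1n leq_add2r.
have S_le e : e <= 3 * l + 2 -> (m + l) ^ e <= (m + l) ^ (3 * l + 2).
  by apply: leq_pexp2l; rewrite addn_gt0 m_gt0.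
rewrite -{1}[m]expn1 -(addn1 2) mulnDl mul1n mul2n -addnn !leq_add //.
- by apply: leq_trans (S_le (1 + l.+4) _); [rewrite expnD leq_mul | lia].
- by apply: leq_trans (S_le (l.+1 + l.+3) _); [rewrite expnD leq_mul | lia].
- by apply: leq_trans (S_le (2 + l.+2) _); [rewrite expnD leq_mul | lia].
Qed.

(** At [l = 1] the three terms are [32 * m], [16 * m ^ 2] and [4 * m ^ 3], times [n]. *)
Lemma grid_cost1_le n m : 0 < m -> grid_cost n m 1 <= 52 * (m ^ 3 * n).
Proof.
move=> m_gt0; rewrite /grid_cost [m ^ 3 * n]mulnC mulnCA leq_mul2l; apply/orP; right.
by rewrite !expnS !expn0; nia.
Qed.

Local Open Scope ring_scope.

(** * Real estimates: entropy, real exponents, memory of the polynomials *)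

Section RealBounds.
Variable R : realType.

(** Both logarithms are nonpositive on the unit interval; this makes the exponential factor of the
    claim at least one. *)
Lemma binary_entropy_ge0 (x : R) : 0 <= x <= 1 -> 0 <= binary_entropy x.
Proof.
move=> /andP[x_ge0 x_le1]; rewrite /binary_entropy.
have h (y : R) : 0 <= y -> y <= 1 -> 0 <= - (y * ln y).
  by move=> y_ge0 y_le1; rewrite oppr_ge0 mulr_ge0_le0 ?ln_le0.
by rewrite addr_ge0 ?h ?subr_ge0 // gerBl.
Qed.

Lemma powR_nat_lbound (x e : R) (n : nat) : 1 <= x -> n%:R <= e -> x ^+ n <= x `^ e.
Proof.
by move=> x_ge1 le_ne; rewrite -powR_mulrn ?(le_trans ler01) // ler_powR.
Qed.

(** Each of the [l.+1] polynomials has at most [2 * l ^ l] monomials of at most [4 * l * t] bits,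
    where [t] is the binary logarithm of [l]; finally [l.+1 <= 2 * l]. *)
Lemma polynomial_memory_le (l : nat) : (1 < l)%N ->
  polynomial_memory R l <= 16 / ln 2 * (l%:R `^ (l%:R + 5 / 2) * ln l%:R).
Proof.
move=> l_gt1; have l_ge2 : 2 <= l%:R :> R by rewrite (ler_nat R 2 l).
have ln2_gt0 : 0 < ln 2 :> R by rewrite ln_gt0 // ltr1n.
have ln2_le : ln 2 <= ln l%:R :> R by rewrite ler_ln ?posrE ?ltr0n // ltnW.
set t : R := ln l%:R / ln 2.
have t_ge1 : 1 <= t by rewrite /t ler_pdivlMr // mul1r.
have term_le k : (k <= l)%N ->
    (size (Ppoly k))%:R * (1 + k.+1%:R * (ln k.+1%:R / ln 2))
    <= 2 * l%:R ^+ l * (4 * l%:R * t) :> R.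
  move=> le_kl; have lnk_ge0 : 0 <= ln k.+1%:R :> R by rewrite ln_ge0 // ler1n.
  apply: ler_pM => //.
  - by rewrite addr_ge0 // mulr_ge0 // divr_ge0 // ltW.
  - by rewrite -natrX -natrM ler_nat Ppoly_size // ltnW.
  (* Indeed [k.+1 <= l.+1 <= l ^ 2], as [l] is at least 2. *)
  have lnk_le : ln k.+1%:R <= 2 * ln l%:R :> R.
    rewrite mulr_natl -lnXn ?ltr0n ?(ltnW l_gt1) // ler_ln ?posrE ?ltr0n //.
      by rewrite -natrX ler_nat; move: l_gt1 le_kl; rewrite expnS expn1; nia.
    by rewrite exprn_gt0 // ltr0n ltnW.
  have k_le : k.+1%:R <= l%:R + 1 :> R by rewrite -natr1 lerD2r ler_nat.
  have frac_le : ln k.+1%:R / ln 2 <= 2 * t.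
    by rewrite /t mulrA ler_pM2r ?invr_gt0.
  have := ler_pM (ler0n R k.+1) (divr_ge0 lnk_ge0 (ltW ln2_gt0)) k_le frac_le.
  by nra.
rewrite /polynomial_memory big_seq.
apply: le_trans (ler_sum _ (G := fun=> 2 * l%:R ^+ l * (4 * l%:R * t)) _) _.
  by move=> k; rewrite mem_index_iota => /andP[_ /term_le].
rewrite -big_seq big_const_seq count_predT size_iota subn0 iter_addr_0.
have pow_le := powR_nat_lbound (le_trans (ler1n R 2) l_ge2)
  (_ : (l + 2)%:R <= l%:R + 5 / 2 :> R).
apply: (@le_trans _ _ (16 * l%:R ^+ (l + 2) * t)); last first.
  rewrite /t; have -> (p : R) : 16 / ln 2 * (p * ln l%:R) = 16 * p * (ln l%:R / ln 2).
    by field; rewrite gt_eqF.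
  rewrite ler_pM2r ?(lt_le_trans ltr01) // ler_pM2l //; apply: pow_le.
  by rewrite natrD lerD2l; lra.
rewrite exprD expr2 -[_ *+ l.+1]mulr_natr -[l.+1%:R]natr1.
have : 0 <= l%:R ^+ l * (l%:R * t) :> R.
  by rewrite mulr_ge0 ?exprn_ge0 // mulr_ge0 // (le_trans ler01).
set W := l%:R ^+ l; set x := l%:R => h.
have -> : 2 * W * (4 * x * t) = 8 * (W * (x * t)) by ring.
have -> : 16 * (W * (x * x)) * t = 8 * (W * (x * t)) * (2 * x) by ring.
by rewrite ler_wpM2l ?(mulr_ge0 (ler0n R 8) h) //; have x_ge2 : 2 <= x := l_ge2; lra.
Qed.

(** P_0 is one monomial of one bit and P_1 consists of two monomials of three bits. *)
Lemma polynomial_memory1 : polynomial_memory R 1 = 7.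
Proof.
have ln2_neq0 : ln 2 != 0 :> R by rewrite gt_eqF // ln_gt0 // ltr1n.
rewrite /polynomial_memory !big_nat_recl // big_geq // ln1 mul0r mulr0 divff //=.
by rewrite !addr0 !mulr1; lra.
Qed.

End RealBounds.

Theorem theorem6 (R : realType) :
  (exists C : R, 0 < C /\
    forall (X Y : finType) (pb : rd_problem R X Y) (l : nat)
      (handler : bifurcation_handler R Y) (grid : seq R) (a : approximation R Y),
      (2 <= l)%N -> sorted >%R grid ->
      let N : R := #|X|%:R in
      let M : R := #|Y|%:R in
      let L : R := l%:R in
      let rho : R := 2 * M / (2 * M + L) in
      (computational_complexity pb l handler grid a)%:R <=
        C * (N * (M + L) `^ (3 * L + 5 / 2)
               * expR ((2 * M + L) * binary_entropy rho
                       + pi * Num.sqrt (2 * L / 3)))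
          * (size grid)%:R)
  /\
  (exists C : R, 0 < C /\
    forall (X Y : finType) (pb : rd_problem R X Y)
      (handler : bifurcation_handler R Y) (grid : seq R) (a : approximation R Y),
      sorted >%R grid ->
      let N : R := #|X|%:R in
      let M : R := #|Y|%:R in
      (computational_complexity pb 1 handler grid a)%:R <=
        C * (M ^+ 3 * N) * (size grid)%:R)
  /\
  (exists C1 C2 C3 : R, [/\ 0 < C1, 0 < C2, 0 < C3 &
    forall (X Y : finType) (pb : rd_problem R X Y) (l : nat)
      (handler : bifurcation_handler R Y) (grid : seq R) (a : approximation R Y),
      (1 <= l)%N -> sorted >%R grid ->
      let N : R := #|X|%:R in
      let M : R := #|Y|%:R in
      let L : R := l%:R in
      memory_complexity pb l handler grid a <=
        C1 * (L `^ (L + 5 / 2) * ln L)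
        + C2 * (M * N * L ^+ 2)
        + C3 * (M ^+ l * L)]).
Proof.
(* [105] is the constant of [root_tracking_cost]; [3] and [52] are those of [grid_cost_le] and
   [grid_cost1_le]. *)
split; [exists (105 * 3); split; first lra |
  split; [exists (105 * 52); split; first lra |]].
- move=> X Y pb l handler grid a l_ge2 _; cbv zeta.
  set N : R := #|X|%:R; set M : R := #|Y|%:R; set L : R := l%:R.
  set rho := 2 * M / (2 * M + L).
  have M_gt0 := reproduction_gt0 pb; have l_gt0 : (0 < l)%N by exact: ltnW.
  have M_ge1 : 1 <= M by rewrite ler1n.
  have L_ge0 : 0 <= L by exact: ler0n.
  have cost_le : (computational_complexity pb l handler grid a
      <= 105 * 3 * (#|X| * (#|Y| + l) ^ (3 * l + 2)) * size grid)%N.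
    apply: leq_trans (root_tracking_cost _ _ _ _ l_gt0) _.
    rewrite mulnC leq_mul2r -mulnA leq_mul2l /=.
    by rewrite grid_cost_le ?orbT.
  rewrite -(ler_nat R) in cost_le; apply: le_trans cost_le _.
  rewrite !natrM natrX natrD -/N -/M -/L ler_wpM2r //; apply: ler_wpM2l; first by lra.
  have pow_le : (M + L) ^+ (3 * l + 2) <= (M + L) `^ (3 * L + 5 / 2).
    apply: powR_nat_lbound; first by lra.
    by rewrite natrD natrM -/L lerD2l; lra.
  (* The inserted factor 1 is compared with the exponential, whose exponent is nonnegative because
     [rho] lies in the unit interval. *)
  rewrite -[leLHS]mulr1 ler_pM //.
  + by rewrite mulr_ge0 // exprn_ge0 // addr_ge0 // (le_trans ler01).
  + by rewrite ler_wpM2l.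
  have den_gt0 : 0 < 2 * M + L by lra.
  rewrite -{1}expR0 ler_expR addr_ge0 ?(mulr_ge0 (pi_ge0 R)) ?sqrtr_ge0 //.
  apply: mulr_ge0; first exact: ltW.
  apply: binary_entropy_ge0; apply/andP; split; first by rewrite divr_ge0 //; lra.
  by rewrite ler_pdivrMr // mul1r; lra.
- move=> X Y pb handler grid a _; cbv zeta; set N : R := #|X|%:R; set M : R := #|Y|%:R.
  have cost_le : (computational_complexity pb 1 handler grid a
      <= 105 * 52 * (#|Y| ^ 3 * #|X|) * size grid)%N.
    apply: leq_trans (@root_tracking_cost R X Y pb 1 handler grid a isT) _.
    rewrite mulnC leq_mul2r -mulnA leq_mul2l /=.
    by rewrite grid_cost1_le ?orbT ?(reproduction_gt0 pb).
  by rewrite -(ler_nat R) !(natrX, natrM) in cost_le.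
(* The last constant is [2 + 7]: [2] from the memorized tensors and [7] from
   [polynomial_memory1]. *)
exists (16 / ln 2), 10, 9; split => //.
  by rewrite divr_gt0 // ln_gt0 // ltr1n.
move=> X Y pb l handler grid a l_gt0 _; cbv zeta.
set N : R := #|X|%:R; set M : R := #|Y|%:R; set L : R := l%:R.
have := max_grid_memory_le pb handler grid a l_gt0.
rewrite -(ler_nat R) natrD !natrM !natrX -/N -/M -/L => grid_le.
rewrite /memory_complexity; set g := (\max_(_ <- _) _)%:R in grid_le *.
have M_ge1 : 1 <= M by rewrite ler1n (reproduction_gt0 pb).
have ML_ge0 : 0 <= M ^+ l * L by rewrite mulr_ge0 // exprn_ge0 // (le_trans ler01).
have [l_gt1|l_le1] := ltnP 1 l.
  by have := polynomial_memory_le R l_gt1; rewrite -/L; lra.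
(* As ln 1 = 0, for l = 1 the polynomials are absorbed in the last term. *)
have l1 : l = 1%N by apply/eqP; rewrite eqn_leq l_le1.
move: grid_le; rewrite /L l1 polynomial_memory1 ln1 mulr0 mulr0 add0r expr1 mulr1.
by lra.
Qed.
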